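(* Let $R=\{(a,b): a,b\in\{1,2,3\}\}$. Then $(123,R)\sim_d(132,R)$.
   Context: $S_n$ denotes the set of permutations of $[n]=\{1,\dots,n\}$, written $\pi=\pi_1\cdots\pi_n$. A mesh pattern of length $k$ is a pair $(\tau,R)$ with $\tau\in S_k$ and $R\subseteq\{0,1,\dots,k\}^2$ (the shaded boxes; box $(a,b)$ is the unit square $[a,a+1]\times[b,b+1]$ in the diagram of $\tau$). An occurrence of $(\tau,R)$ in $\pi\in S_n$ is a choice of indices $i_1<\dots<i_k$ such that $\pi_{i_1}\cdots\pi_{i_k}$ is order-isomorphic to $\tau$ and, with $i_0=0$, $i_{k+1}=n+1$, $v_1<\dots<v_k$ the values $\pi_{i_1},\dots,\pi_{i_k}$ sorted increasingly, $v_0=0$, $v_{k+1}=n+1$, for every $(a,b)\in R$ there is no index $m$ with $i_a<m<i_{a+1}$ and $v_b<\pi_m<v_{b+1}$. Mesh patterns $p,q$ are equidistributed, $p\sim_d q$, if for all $n,\ell\ge0$ the number of $\pi\in S_n$ with exactly $\ell$ occurrences of $p$ equals the number with exactly $\ell$ occurrences of $q$. *)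

(* Defs.v *)
From mathcomp Require Import all_boot all_fingroup.

Set Implicit Arguments.
Unset Strict Implicit.
Unset Printing Implicit Defensive.

(* Elements of 'S_n permute {0, ..., n-1}; positions and values are shifted by
   one below, so that they range over {1, ..., n} with sentinels 0 and n+1. *)

Record mesh_pattern (k : nat) := MeshPattern {
  mesh_perm : 'S_k;
  mesh_shading : {set 'I_k.+1 * 'I_k.+1}
}.

Section Occurrences.

Variables (k n : nat) (p : mesh_pattern k) (pi : 'S_n) (t : k.-tuple 'I_n).

Definition order_isomorphic : bool :=
  [forall a : 'I_k, forall b : 'I_k,
    (pi (tnth t a) < pi (tnth t b)) == (mesh_perm p a < mesh_perm p b)].

(* [:: i_0; i_1; ...; i_(k+1)] *)
Definition position_bounds : seq nat :=
  0 :: rcons [seq (val i).+1 | i <- t] n.+1.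

(* [:: v_0; v_1; ...; v_(k+1)] *)
Definition value_bounds : seq nat :=
  0 :: rcons (sort leq [seq (val (pi i)).+1 | i <- t]) n.+1.

Definition empty_box (a b : nat) : bool :=
  [forall m : 'I_n,
    ~~ ((nth 0 position_bounds a < m.+1 < nth 0 position_bounds a.+1) &&
        (nth 0 value_bounds b < (pi m).+1 < nth 0 value_bounds b.+1))].

Definition is_occurrence : bool :=
  [&& sorted ltn [seq val i | i <- t],
      order_isomorphic
    & [forall c in mesh_shading p, empty_box c.1 c.2]].

End Occurrences.

Definition occurrences (k n : nat) (p : mesh_pattern k) (pi : 'S_n) : nat :=
  #|[set t : k.-tuple 'I_n | is_occurrence p pi t]|.

Definition equidistributed (k k' : nat)
    (p : mesh_pattern k) (q : mesh_pattern k') : Prop :=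
  forall n l : nat,
    #|[set pi : 'S_n | occurrences p pi == l]| =
    #|[set pi : 'S_n | occurrences q pi == l]|.

Definition perm123 : 'S_3 := 1%g.

Definition perm132 : 'S_3 := tperm (inord 1) (inord 2).

Lemma perm123_one_line : [seq (val (perm123 i)).+1 | i : 'I_3] = [:: 1; 2; 3].
Proof. by rewrite /image_mem enum_ordSl enum_ordSl enum_ordSl enum_ord0 /= !perm1. Qed.

Lemma perm132_one_line : [seq (val (perm132 i)).+1 | i : 'I_3] = [:: 1; 3; 2].
Proof.
rewrite /image_mem enum_ordSl enum_ordSl enum_ordSl enum_ord0 /= /perm132.
by rewrite !permE /= -!val_eqE /= !inordK.
Qed.

Definition shading_R : {set 'I_4 * 'I_4} :=
  [set c : 'I_4 * 'I_4 | (1 <= c.1 <= 3) && (1 <= c.2 <= 3)].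

(* Main.v *)
(* Both patterns force the entry playing 1 to have exactly two larger entries
   to its right; they differ in whether these two entries increase or decrease.
   Build a permutation from right to left, each time prepending an entry of
   chosen relative value.  An entry prepended with exactly two larger ones
   creates an occurrence of one of the patterns, according to the order of the
   current two largest entries, and this order is reset only when the new entry
   is the largest (decreasing) or the second largest (increasing).  Exchanging
   these two choices at every step reverses the order throughout, and hence
   exchanges the occurrences of the two patterns. *)
Require Import Defs.
From mathcomp Require Import all_boot all_fingroup.
From mathcomp Require Import zify.

Set Implicit Arguments.
Unset Strict Implicit.
Unset Printing Implicit Defensive.

(** * Occurrences as entries with exactly two larger entries to their right *)

Definition top_pair n (b : bool) (s : 'S_n) (i a c : 'I_n) : bool :=
  [&& i < a < c, s i < s a, s i < s c, (s a < s c) == b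
    & [forall m : 'I_n, (i < m) && (s i < s m) ==> (m == a) || (m == c)]].

Definition pattern1 (b : bool) : 'S_3 := if b then perm123 else perm132.

Lemma order_isomorphicE n (b : bool) R (s : 'S_n) (i a c : 'I_n) :
  i < a < c ->
  order_isomorphic (MeshPattern (pattern1 b) R) s [tuple i; a; c] =
  [&& s i < s a, s i < s c & (s a < s c) == b].
Proof.
move=> iac.
have ne (x y : 'I_n) : x != y :> nat -> s x != s y :> nat.
  by apply: contra => /eqP/val_inj/perm_inj ->.
have Nia : s i != s a :> nat by apply: ne; lia.
have Nic : s i != s c :> nat by apply: ne; lia.
have Nac : s a != s c :> nat by apply: ne; lia.
have all3 (P : pred 'I_3) : [forall x, P x] =
    [&& P ord0, P (inord 1) & P (inord 2)].
  apply/forallP/and3P => [H|[H0 H1 H2] [x lx]]; first by split; apply: H.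
  case: x lx => [|[|[|//]]] lx.
  - by rewrite (_ : Ordinal lx = ord0) //; apply: val_inj.
  - by rewrite (_ : Ordinal lx = inord 1) //; apply: val_inj; rewrite /= inordK.
  - by rewrite (_ : Ordinal lx = inord 2) //; apply: val_inj; rewrite /= inordK.
rewrite /order_isomorphic !all3 /= !(tnth_nth i) /= !inordK //=.
case: b; rewrite /= /perm123 /perm132; last first.
  by rewrite !permE /= -!val_eqE /= !inordK //=; lia.
by rewrite !perm1 /= !inordK //=; lia.
Qed.

Lemma sort3 n (b : bool) (s : 'S_n) (i a c : 'I_n) :
  s i < s a -> s i < s c -> (s a < s c) = b ->
  sort leq [:: (val (s i)).+1; (val (s a)).+1; (val (s c)).+1] =
  [:: (val (s i)).+1; (val (s (if b then a else c))).+1;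
      (val (s (if b then c else a))).+1].
Proof.
move=> sia sic sac.
apply: (sorted_eq leq_trans anti_leq).
- exact: (sort_sorted leq_total).
- by case: b sac => sac /=; lia.
- rewrite perm_sort; case: b sac => _ //=.
  by rewrite perm_cons (perm_catC [:: _] [:: _]).
Qed.

Lemma in_shading_R (x y : 'I_4) : ((x, y) \in shading_R) = (0 < x) && (0 < y).
Proof. by rewrite inE /= (leq_ord x) (leq_ord y) !andbT. Qed.

(** The nine shaded boxes fill the quadrant right of [i] and above [s i], up to the grid lines
    through the other two points. Since [s] is injective, those lines carry no further entry, so the
    boxes are empty iff the quadrant holds only these two points. *)
Lemma is_occurrenceE n (b : bool) (s : 'S_n) (i a c : 'I_n) :
  is_occurrence (MeshPattern (pattern1 b) shading_R) s [tuple i; a; c] =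
  top_pair b s i a c.
Proof.
rewrite /is_occurrence /top_pair /= andbT.
case iac: (i < a < c) => //=.
rewrite order_isomorphicE // -!andbA.
case sia: (s i < s a) => //=; case sic: (s i < s c) => //=.
case sac: ((s a < s c) == b) => //=; move/eqP: sac => sac.
have ne (x y : 'I_n) : x != y -> s x != s y :> nat.
  by apply: contra => /eqP/val_inj/perm_inj ->.
rewrite /empty_box /position_bounds /value_bounds /= (sort3 sia sic sac) /=.
(* Positions of the lower and of the higher of the two upper points; from here on [b] is
   irrelevant. *)
set p := if b then a else c; set q := if b then c else a.
have spq : s p < s q.
  have := ne a c; rewrite /p /q; case: b sac {p q} => sac ac; first by [].
  by have := ac ltac:(apply: contraTneq iac => ->; lia); lia.
have sip : s i < s p by rewrite /p; case: b {sac p q spq}.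
have smpq (m : 'I_n) : m != a -> m != c -> s m != s p :> nat /\ s m != s q :> nat.
  by move=> ma mc; split; apply: ne; rewrite ?/p ?/q; case: (b).
clearbody p q; clear b sac ne.
apply/forall_inP/forallP => [H m|H [x y]].
  apply/implyP => /andP[im sim]; apply: contraT; rewrite negb_or => /andP[ma mc].
  have [smp smq] := smpq m ma mc.
  have ma' : m != a :> nat by [].
  have mc' : m != c :> nat by [].
  (* Column and row of the shaded box that would contain the extra entry at [m]. *)
  pose x := if m < a then 1 else if m < c then 2 else 3.
  pose y := if s m < s p then 1 else if s m < s q then 2 else 3.
  have lx : 0 < x < 4 by rewrite /x; do 2 case: ifP => //.
  have ly : 0 < y < 4 by rewrite /y; do 2 case: ifP => //.
  have [/andP[x0 x4] /andP[y0 y4]] := (lx, ly).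
  have xyR : (Ordinal x4, Ordinal y4) \in shading_R by rewrite in_shading_R x0 y0.
  have /forallP/(_ m) := H _ xyR; move: (ltn_ord m) (ltn_ord (s m)).
  rewrite /= /x /y {xyR lx ly x y x0 x4 y0 y4 H smpq ma mc}.
  by case: (ltnP m a) => ? /=; [|case: (ltnP m c) => ? /=];
     (case: (ltnP (s m) (s p)) => ? /=; [|case: (ltnP (s m) (s q)) => ? /=]);
     move=> ? ? /negP[]; rewrite -!andbA; apply/and4P; split; lia.
rewrite in_shading_R => /andP[xR yR]; apply/forallP => m.
have := H m; apply: contraTN; rewrite negb_imply negb_or => xy.
(* Box bounds are strict and [a], [c] are column boundaries, so [m] is neither. *)
have [-> ->] : m != a /\ m != c; last first.
  case: x y xR yR xy => [[|[|[|[|x]]]] lx] [[|[|[|[|y]]]] ly] //= _ _; lia.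
split; apply: contraTneq xy => ->.
  by case: x xR => [[|[|[|[|x]]]] lx] //= _; lia.
by case: x xR => [[|[|[|[|x]]]] lx] //= _; lia.
Qed.

Definition top_pairs n (b : bool) (s : 'S_n) : nat :=
  \sum_i \sum_a \sum_c top_pair b s i a c.

Lemma occurrencesE n (b : bool) (s : 'S_n) :
  occurrences (MeshPattern (pattern1 b) shading_R) s = top_pairs b s.
Proof.
rewrite /occurrences /top_pairs -sum1dep_card big_mkcond /=.
rewrite pair_big pair_big /=.
rewrite (reindex (fun x : 'I_n * 'I_n * 'I_n => [tuple x.1.1; x.1.2; x.2])) /=.
  by apply: eq_bigr => -[[i a] c] _ /=; rewrite is_occurrenceE; case: top_pair.
exists (fun t : 3.-tuple 'I_n =>
  (tnth t ord0, tnth t (inord 1), tnth t (inord 2))) => [[[i a] c] _|t _].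
  by rewrite !(tnth_nth i) /= !inordK.
case: t => -[|i [|a [|c [|]]]] // st; apply: val_inj => /=.
by rewrite !(tnth_nth i) /= !inordK.
Qed.

(** * Effect of prepending an entry: [lift_perm ord0 j s] puts [j] in front of [s] *)

Definition top_asc n (s : 'S_n.+2) : bool :=
  (s^-1 (inord n) < s^-1 ord_max)%g.

(** The condition looks only at positions from [i] on and at relative order, and prepending an entry
    changes neither. *)
Lemma top_pair_lift n b (j : 'I_n.+1) (s : 'S_n) (i a c : 'I_n) :
  top_pair b (lift_perm ord0 j s) (lift ord0 i) (lift ord0 a) (lift ord0 c) =
  top_pair b s i a c.
Proof.
have ltl m (h : 'I_m.+1) x y : (lift h x < lift h y) = (x < y).
  rewrite /= /bump; lia.
rewrite /top_pair !lift_perm_lift !ltl; do 4 congr andb.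
apply/forallP/forallP => H m.
  by have := H (lift ord0 m); rewrite lift_perm_lift !ltl !(inj_eq lift_inj).
case: (unliftP ord0 m) => [k ->|->].
  by rewrite lift_perm_lift !ltl !(inj_eq lift_inj); apply: H.
by [].
Qed.

Lemma top_pairs_small n b (s : 'S_n) : n < 3 -> top_pairs b s = 0.
Proof.
move=> n3; rewrite /top_pairs big1 // => i _; rewrite big1 // => a _.
rewrite big1 // => c _; rewrite /top_pair.
by case iac: (i < a < c) => //=; move: (ltn_ord c); lia.
Qed.

(** Indexed so that, when the two largest entries appear in order [b], the left one is
    [top_value n b] and the right one [top_value n (~~ b)]. *)
Definition top_value n (second : bool) : 'I_n.+2 :=
  if second then inord n else ord_max.

(** The front entry [j] has [n + 2 - j] larger entries after it, which is two only for [j = n].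
    These are then the two largest of [s], so [a] and [c] are determined by [s]. *)
Lemma top_pair_lift0 n b (j : 'I_n.+3) (s : 'S_n.+2) (a c : 'I_n.+3) :
  top_pair b (lift_perm ord0 j s) ord0 a c =
  [&& (j == n :> nat) && (top_asc s == b),
      a == lift ord0 (s^-1 (top_value n b))%g
    & c == lift ord0 (s^-1 (top_value n (~~ b)))%g].
Proof.
have topE d : top_value n d = (if d then n else n.+1) :> nat.
  by rewrite /top_value; case: d => //=; rewrite inordK.
have ltj (x : 'I_n.+2) : (j < lift j x) = (j <= x) by rewrite /= /bump; lia.
have ltl m (h : 'I_m.+1) x y : (lift h x < lift h y) = (x < y).
  by rewrite /= /bump; lia.
rewrite /top_pair lift_perm_id.
case: (unliftP ord0 a) => [a' ->|->]; last by rewrite ltnn /= andbF.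
case: (unliftP ord0 c) => [c' ->|->]; last by rewrite ltn0 !andbF.
rewrite !lift_perm_lift !ltj !ltl !(inj_eq lift_inj) /=.
have eqV x v : (x == s^-1 v)%g = (s x == v).
  by rewrite -(inj_eq (@perm_inj _ s)) permKV.
rewrite !eqV -!val_eqE /= !topE.
have sub (m : 'I_n.+3) : (0 < m) && (j < lift_perm ord0 j s m) =
    if unlift ord0 m is Some m' then j <= s m' else false.
  by case: (unliftP ord0 m) => [m' ->|-> //]; rewrite lift_perm_lift ltj.
apply/and5P/and3P => [[ac ja jc bE /forallP H]|[/andP[/eqP jE ascE] sa sc]].
  have H' (v : 'I_n.+2) : j <= v -> v = s a' :> nat \/ v = s c' :> nat.
    move=> jv; have := H (lift ord0 (s^-1 v)%g).
    rewrite sub liftK permKV jv /= !(inj_eq lift_inj) => /orP[]/eqP <-.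
      by left; rewrite permKV.
    by right; rewrite permKV.
  have sac : s a' != s c' :> nat.
    by apply: contraTneq ac => /val_inj/perm_inj ->; rewrite ltnn.
  have := ltn_ord (s a'); have := ltn_ord (s c') => ltc lta.
  have H0 := H' (top_value n true); have H1 := H' (top_value n false).
  rewrite !topE /= in H0 H1.
  have jn : j = n :> nat.
    have jn : j <= n by move: ja jc sac; lia.
    apply/eqP; rewrite eqn_leq jn leqNgt; apply/negP => jltn.
    (* For [j < n] the three values [n - 1], [n], [n + 1] would have to fit in the two positions
       [a'] and [c']. *)
    have := H' (inord n.-1); rewrite inordK; lia.
  have [sa sc] : s a' = (if b then n else n.+1) :> nat /\
                 s c' = (if ~~ b then n else n.+1) :> nat.
    by move: bE; case: (b) => /eqP bE /=; lia.
  rewrite jn sa sc !eqxx; split=> //=.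
  have Va : (s^-1 (top_value n b))%g = a'.
    by apply: (@perm_inj _ s); rewrite permKV; apply: val_inj; rewrite /= topE.
  have Vc : (s^-1 (top_value n (~~ b)))%g = c'.
    by apply: (@perm_inj _ s); rewrite permKV; apply: val_inj; rewrite /= topE.
  rewrite /top_asc -[inord n]/(top_value n true) -[ord_max]/(top_value n false).
  by case: (b) Va Vc => /= -> ->; [rewrite ac|rewrite ltnNge ltnW].
have Va : (s^-1 (top_value n b))%g = a'.
  by apply: (@perm_inj _ s); rewrite permKV; apply: val_inj; rewrite /= topE (eqP sa).
have Vc : (s^-1 (top_value n (~~ b)))%g = c'.
  by apply: (@perm_inj _ s); rewrite permKV; apply: val_inj; rewrite /= topE (eqP sc).
have ac : a' != c' :> nat.
  by apply/eqP => /val_inj E; move: sa sc; rewrite E; case: (b) => /=; lia.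
split.
- move: ascE; rewrite /top_asc.
  rewrite -[inord n]/(top_value n true) -[ord_max]/(top_value n false).
  case: (b) Va Vc => /= -> -> /eqP // ca.
  by rewrite ltn_neqAle ac leqNgt ca.
- by rewrite (eqP sa) jE; case: (b).
- by rewrite (eqP sc) jE; case: (b).
- by rewrite (eqP sa) (eqP sc); case: (b) => /=; lia.
apply/forallP => m; rewrite sub; apply/implyP.
case: (unliftP ord0 m) => [m' ->|-> //]; rewrite jE !(inj_eq lift_inj) => nm.
have eqs x : (m' == x) = (s m' == s x :> nat) by rewrite val_eqE (inj_eq perm_inj).
rewrite !eqs.
have := ltn_ord (s m'); move: nm; rewrite (eqP sa) (eqP sc).
by case: (b) => /=; lia.
Qed.

Lemma top_pairs_lift n b (j : 'I_n.+3) (s : 'S_n.+2) :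
  top_pairs b (lift_perm ord0 j s) =
  top_pairs b s + ((j == n :> nat) && (top_asc s == b)).
Proof.
rewrite {1}/top_pairs big_ord_recl addnC; congr (_ + _).
  apply: eq_bigr => i _; rewrite big_ord_recl [X in X + _]big1 ?add0n => [|c _].
    apply: eq_bigr => a _; rewrite big_ord_recl {1}/top_pair ltn0 andbF add0n.
    by apply: eq_bigr => c _; rewrite top_pair_lift.
  by rewrite /top_pair ltn0.
under eq_bigr => a _ do under eq_bigr => c _ do rewrite top_pair_lift0.
case: andP => _; last by rewrite big1 // => a _; rewrite big1.
set a0 := lift _ _; set c0 := lift _ _.
rewrite (bigD1 a0) //= (bigD1 c0) //= !eqxx !big1 //.
  by move=> a /negPf->; rewrite big1.
by move=> c /negPf->.
Qed.

(** A front entry that is largest or second largest stands left of the other one and so fixes the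
    order; a smaller one leaves the two largest of [s] in place. *)
Lemma top_asc_lift n (j : 'I_n.+3) (s : 'S_n.+2) :
  top_asc (lift_perm ord0 j s) =
  if j == ord_max then false else (j == inord n.+1) || top_asc s.
Proof.
rewrite /top_asc lift_permV.
have [->|jmax] := eqVneq j ord_max; first by rewrite lift_perm_id ltn0.
have -> : ord_max = lift j ord_max.
  apply: val_inj; move: jmax; rewrite -val_eqE /= /bump.
  by move: (ltn_ord j); lia.
rewrite lift_perm_lift.
have [<-|jn] := eqVneq j (inord n.+1); first by rewrite lift_perm_id.
have -> : inord n.+1 = lift j (inord n).
  apply: val_inj; move: jmax jn; rewrite -!val_eqE /= /bump !inordK //.
  by move: (ltn_ord j); lia.
by rewrite lift_perm_lift /= /bump; lia.
Qed.

(** * Summation over the front entry and induction on the size *)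

Lemma big_lift_perm n (G : 'S_n.+1 -> nat) :
  \sum_s G s = \sum_j \sum_s G (lift_perm ord0 j s).
Proof.
rewrite pair_big /=; apply: reindex; apply: onW_bij.
(* Both sides have [(n + 1)!] elements, so injectivity suffices. *)
apply: inj_card_bij; last by rewrite card_prod card_ord !card_Sn.
move=> [j s] [j' s'] /= E.
have Ej : j = j' by have := congr1 (fun p : 'S_n.+1 => p ord0) E; rewrite !lift_perm_id.
rewrite -Ej in E *; congr pair; apply/permP => i.
have := congr1 (fun p : 'S_n.+1 => p (lift ord0 i)) E.
by rewrite !lift_perm_lift; apply: lift_inj.
Qed.

Lemma top_asc_tperm n (s : 'S_n.+2) :
  top_asc (s * tperm (inord n) ord_max)%g = ~~ top_asc s.
Proof.
rewrite /top_asc invMg tpermV !permM tpermL tpermR.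
rewrite -leqNgt [RHS]leq_eqVlt.
by rewrite (inj_eq val_inj) (inj_eq perm_inj) -val_eqE /= inordK // gtn_eqF.
Qed.

(** The order of the two largest entries decides whether the next step adds an occurrence, so the
    induction needs its joint distribution with the count. The arbitrary [F] expresses this and
    absorbs the increments. *)
Lemma sum_top_pairs_asc n (F : nat -> bool -> nat) :
  \sum_(s : 'S_n.+2) F (top_pairs true s) (top_asc s) =
  \sum_(s : 'S_n.+2) F (top_pairs false s) (~~ top_asc s).
Proof.
elim: n F => [|n IH] F.
  rewrite (reindex_inj (mulIg (tperm (inord 0) ord_max))).
  by apply: eq_bigr => s _; rewrite !top_pairs_small // top_asc_tperm.
have ne : (inord n.+1 == ord_max :> 'I_n.+3) = false.
  by rewrite -val_eqE /= inordK //; lia.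
rewrite !big_lift_perm.
(* On the right, the largest and second largest choices of front entry are exchanged. *)
rewrite [RHS](reindex_inj (@perm_inj _ (tperm (inord n.+1) ord_max))).
apply: eq_bigr => j _.
under eq_bigr => s _ do rewrite top_pairs_lift top_asc_lift.
under [RHS]eq_bigr => s _ do rewrite top_pairs_lift top_asc_lift.
case: tpermP => [->|->|/eqP/negPf jn /eqP/negPf jmax].
(* Neither exchanged value is [n], so nothing is added; the order is reset to opposite values on the
   two sides, which the negation makes equal. *)
- rewrite ne !eqxx /= inordK // !(gtn_eqF (leqnSn _)) gtn_eqF //=.
  exact: (IH (fun x _ => F (x + 0) true)).
- rewrite ne !eqxx /= inordK // !(gtn_eqF (leqnSn _)) gtn_eqF //=.
  exact: (IH (fun x _ => F (x + 0) false)).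
- rewrite jn jmax /=.
  under eq_bigr do rewrite eqb_id.
  under [RHS]eq_bigr do rewrite eqbF_neg.
  (* The order is kept, and for [j = n] the increment on either side is the second argument of
     [F]. *)
  exact: (IH (fun x y => F (x + ((j == n :> nat) && y)) y)).
Qed.

Theorem theorem4p1 :
  equidistributed (MeshPattern perm123 shading_R) (MeshPattern perm132 shading_R).
Proof.
move=> n l; rewrite -[perm123]/(pattern1 true) -[perm132]/(pattern1 false).
rewrite -!sum1dep_card big_mkcond [RHS]big_mkcond.
under eq_bigr do rewrite occurrencesE.
under [RHS]eq_bigr do rewrite occurrencesE.
case: n => [|[|n]]; try by apply: eq_bigr => s _; rewrite !top_pairs_small.
(* Taking for [F] the indicator of the count [l] forgets the order. *)
exact: (sum_top_pairs_asc n (fun x _ => if x == l then 1 else 0)).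
Qed.
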